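(* Let $n\ge 0$ be an integer, let $\alpha_0<\alpha_1<\cdots<\alpha_n$ be real numbers, and let $\sigma_0,\dots,\sigma_n\in\{+1,-1\}$. Let $k$ be the number of variations of the sequence $\sigma_0,\dots,\sigma_n$, i.e. the number of indices $i$ with $0\le i\le n-1$ and $\sigma_i=-\sigma_{i+1}$. Let $M$ be an arbitrary finite multiset of positive real numbers, and let $p$ be its cardinality. Then there exist non-zero real numbers $a_0,\dots,a_n$ with $a_i/|a_i|=\sigma_i$ for all $i=0,\dots,n$, such that the multiset of positive roots of $$Y(x)=a_0x^{\alpha_0}+a_1x^{\alpha_1}+\cdots+a_nx^{\alpha_n},\qquad x\in\,]0,+\infty[,$$ is exactly $M$, if and only if $k-p$ is even and non-negative.
   Context: A multiset is defined like a set, except that identical elements are allowed; its cardinality is the number of its elements, identical elements being counted repeatedly. The multiset of positive roots of $Y$ consists of the roots of $Y$ in $]0,+\infty[$, each repeated according to its multiplicity (order of vanishing of the analytic function $Y$ at that root). *)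

(* Defs.v *)
From HB Require Import structures.
From mathcomp Require Import all_boot all_order all_algebra.
From mathcomp Require Import finmap multiset.
From mathcomp Require Import reals normedtype derive exp.
Set Implicit Arguments.
Unset Strict Implicit.
Unset Printing Implicit Defensive.
Import Order.TTheory GRing.Theory Num.Theory.
Import numFieldNormedType.Exports.
Local Open Scope ring_scope.

(* [lift ord0 i : 'I_n.+1] is the index of value i + 1. *)
Definition sign_variations (R : realType) (n : nat) (s : 'I_n.+1 -> R) : nat :=
  #|[set i : 'I_n | s (widen_ord (leqnSn n) i) == - s (lift ord0 i)]|.

Definition gen_poly (R : realType) (n : nat) (alpha a : 'I_n.+1 -> R) : R -> R :=
  fun x => \sum_(i < n.+1) a i * x `^ alpha i.

(* Meant for f smooth near x: [derive1n j f] is a total operator, with no meaningful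
   value where f is not j times derivable. *)
Definition vanishing_order (R : realType) (f : R -> R) (x : R) (m : nat) : Prop :=
  (forall j : nat, (j < m)%N -> derive1n j f x = 0) /\ derive1n m f x <> 0.

(* Only the values of f on ]0, +oo[ matter; [M x] is the multiplicity of x. *)
Definition positive_root_mset (R : realType) (f : R -> R) (M : {mset R}%mset) : Prop :=
  (forall x : R, x \in M <-> 0 < x /\ f x = 0) /\
  (forall x : R, x \in M -> vanishing_order f x (M x)).

(* Main.v *)
Require Import Defs.
From mathcomp Require Import all_boot all_order all_algebra.
From mathcomp Require Import finmap multiset.
From mathcomp Require Import reals normedtype derive exp.
From mathcomp Require Import boolp classical_sets functions topology sequences realfun.
From mathcomp Require Import ring lra.
Import Order.TTheory GRing.Theory Num.Theory.
Import numFieldNormedType.Exports.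
Set Implicit Arguments.
Unset Strict Implicit.
Unset Printing Implicit Defensive.
Local Open Scope ring_scope.

(** Put x = e^t, so that Y becomes the exponential sum
    f(t) = sum_i a_i e^(alpha_i t), whose root t = ln x has the multiplicity of
    the root x of Y.  Multiplicity is an algebraic condition on exponential
    sums: for a polynomial q, q(d/dt) f = sum_i a_i q(alpha_i) e^(alpha_i t) is
    [expsum alpha a q], and f vanishes to order at least m at z when this is 0
    at z for all q of degree less than m.

    Upper bound.  Apply Rolle to e^(-b t) f(t): if f vanishes on a multiset of
    size m+1, the sum with coefficients a_i (alpha_i - b) vanishes on one of
    size m.  Iterating over numbers b_1, ..., b_m until the coefficients
    a_i (alpha_i - b_1) ... (alpha_i - b_m) have one sign gives
    [descartes_bound]: f then has at most m roots.  With one b inside each gap of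
    exponents where the sign of a_i changes, this is p <= k
    ([descartes_variations]).

    Parity.  If f has exactly the roots s, then f(t) / prod_(y in s) (t - y)
    extends to a continuous function without zeros ([quotient]), hence of
    constant sign.  Near +oo this is the sign of a_n, near -oo that of
    (-1)^p a_0, and sigma_n = (-1)^k sigma_0; thus k - p is even.

    Existence.  Given q points and a set S of q + 1 indices, linear algebra
    gives a nonzero sum supported on S that vanishes at the points.
    [descartes_bound], with the b's among the exponents, shows that it vanishes
    nowhere else and that its coefficients alternate in sign
    ([interpolant_signs]).  Cut the indices into the k + 1 maximal blocks on
    which sigma is constant.  For each index j take S to contain j and one index
    of each other block, and the points to be s and a point r outside s repeated
    k - p times; take also one S with one index in each of the last p + 1
    blocks, and the points s.  Scaled to match sigma, all these sums have
    quotients by prod_(y in s) (t - y) of the sign of sigma_n, because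
    (t - r)^(k - p) >= 0, and the last quotient is never zero.  So the sum of
    all of them has root multiset exactly s, and all its coefficients have the
    signs sigma ([exists_exact]). *)

(** * Exponential sums and their vanishing order *)

Lemma is_derive_expRM (R : realType) (c w t : R) :
  is_derive t 1 (fun x : R => c * expR (w * x)) (c * (w * expR (w * t))).
Proof.
have dlin : is_derive t (1 : R) (fun x : R => w * x) w.
  rewrite -[X in is_derive _ _ _ X]mulr1.
  exact: (@is_deriveZ R R^o R^o id w t 1 1 _).
have dexp := is_derive1_comp (is_derive_expR (w * t)) dlin.
have := @is_deriveZ R R^o R^o _ c t 1 _ dexp.
by rewrite /GRing.scale /= [expR _ * w]mulrC.
Qed.

Section ExponentialSums.
Context {R : realType} {I : finType} (alpha : I -> R).
Implicit Types (a : I -> R) (p q : {poly R}) (s : seq R) (b c t z : R).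

(** The value at t of q(d/dt) applied to the sum of the [a i * expR (alpha i * t)].
    The polynomial argument makes multiplicities algebraic: differentiation
    multiplies q by 'X. *)
Definition expsum a q t : R := \sum_i a i * q.[alpha i] * expR (alpha i * t).

(** As q ranges over all polynomials of degree less than the multiplicity of z
    in s, this says that z is a root of at least that order. *)
Definition vanishes a s : Prop :=
  forall z q, (size q <= count_mem z s)%N -> expsum a q z = 0.

Lemma expsumDr a p q t : expsum a (p + q) t = expsum a p t + expsum a q t.
Proof.
rewrite /expsum -big_split /=; apply: eq_bigr => i _.
by rewrite hornerD mulrDr mulrDl.
Qed.

Lemma expsumZr a c q t : expsum a (c *: q) t = c * expsum a q t.
Proof.
rewrite /expsum mulr_sumr; apply: eq_bigr => i _.
by rewrite hornerZ; ring.
Qed.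

Lemma expsumZl c a q t : expsum (fun i => c * a i) q t = c * expsum a q t.
Proof. by rewrite /expsum mulr_sumr; apply: eq_bigr => i _; ring. Qed.

Lemma expsum_suml (J : finType) (a : J -> I -> R) q t :
  expsum (fun i => \sum_j a j i) q t = \sum_j expsum (a j) q t.
Proof.
rewrite /expsum exchange_big /=; apply: eq_bigr => i _.
by rewrite !mulr_suml.
Qed.

Lemma expsum_mul_root a b q t :
  expsum (fun i => a i * (alpha i - b)) q t = expsum a (('X - b%:P) * q) t.
Proof. by apply: eq_bigr => i _; rewrite hornerM hornerXsubC; ring. Qed.

Lemma is_derive_expsum a q t :
  is_derive t 1 (expsum a q) (expsum a ('X * q) t).
Proof.
pose h (k : 'I_#|I|) x := a (enum_val k) * q.[alpha (enum_val k)] *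
              expR (alpha (enum_val k) * x) : R.
have -> : expsum a q = \sum_(k < #|I|) h k.
  apply/funext => x; rewrite fct_sumE /expsum.
  by rewrite (reindex _ (onW_bij _ (@enum_val_bij I))).
have -> : expsum a ('X * q) t =
    \sum_(k < #|I|) a (enum_val k) * q.[alpha (enum_val k)] *
      (alpha (enum_val k) * expR (alpha (enum_val k) * t)).
  rewrite /expsum (reindex _ (onW_bij _ (@enum_val_bij I))) /=.
  by apply: eq_bigr => k _; rewrite hornerM hornerX; ring.
by apply: is_derive_sum => k; exact: is_derive_expRM.
Qed.

Lemma derivable_expsum a q t : derivable (expsum a q) t 1.
Proof. by case: (is_derive_expsum a q t). Qed.

Lemma continuous_expsum a q : continuous (expsum a q).
Proof.
move=> t; apply/differentiable_continuous.
by rewrite -derivable1_diffP; exact: derivable_expsum.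
Qed.

(** Polynomials of each degree below m span all polynomials of degree below m; used
    with the powers of 'X and with the falling factorials. *)
Lemma expsum_basis a z m (P : nat -> {poly R}) :
  (forall j, size (P j) = j.+1) ->
  (forall j, (j < m)%N -> expsum a (P j) z = 0) ->
  forall q, (size q <= m)%N -> expsum a q z = 0.
Proof.
move=> sizeP; elim: m => [|m IHm] P0 q le_q.
  move: le_q; rewrite leqn0 size_poly_eq0 => /eqP ->.
  by rewrite -[0](scale0r 1) expsumZr mul0r.
have lead : (P m)`_m != 0.
  have := lead_coef_eq0 (P m); rewrite lead_coefE sizeP /= => ->.
  by rewrite -size_poly_eq0 sizeP.
pose c := q`_m / (P m)`_m.
rewrite -(subrK (c *: P m) q) expsumDr expsumZr P0 // mulr0 addr0.
apply: IHm => [j lt_jm|]; first by rewrite P0 // ltnW.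
apply/leq_sizeP => j; rewrite leq_eqVlt => /predU1P[<-|lt_mj].
  by rewrite coefB coefZ divfK // subrr.
by rewrite coefB coefZ !nth_default ?sizeP ?mulr0 ?subrr // (leq_trans le_q).
Qed.

Lemma vanishes_sub a s s' : (forall z, (count_mem z s <= count_mem z s')%N) ->
  vanishes a s' -> vanishes a s.
Proof. by move=> le_ss' van z q /leq_trans/(_ (le_ss' z)); exact: van. Qed.

Lemma vanishes_cons a s t : vanishes a s ->
  expsum a 'X^(count_mem t s) t = 0 -> vanishes a (t :: s).
Proof.
move=> van a0 z; apply: (expsum_basis (P := fun j => 'X^j)).
  exact: size_polyXn.
move=> j /=; have [<-|_] := eqVneq t z; last first.
  by rewrite add0n => lt_j; apply: van; rewrite size_polyXn.
rewrite add1n ltnS leq_eqVlt => /predU1P[-> //|lt_j].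
by apply: van; rewrite size_polyXn.
Qed.

End ExponentialSums.

Lemma expsum_shift (R : realType) (I : finType) (alpha a : I -> R)
    (q : {poly R}) (b t : R) :
  expsum (fun i => alpha i - b) a q t =
  expR (- (b * t)) * expsum alpha a (q \Po ('X - b%:P)) t.
Proof.
rewrite /expsum mulr_sumr; apply: eq_bigr => i _.
rewrite horner_comp hornerXsubC mulrBl expRD; ring.
Qed.

(** Rolle's theorem applies to [fun t => expR (- (b * t)) * expsum alpha a 1 t],
    which is again an exponential sum. *)
Lemma rolle_expsum (R : realType) (I : finType) (alpha a : I -> R) (b x y : R) :
  x < y -> expsum alpha a 1 x = 0 -> expsum alpha a 1 y = 0 ->
  exists2 c, x < c < y & expsum alpha a ('X - b%:P) c = 0.
Proof.
move=> xy ax ay; pose g := expsum (fun i => alpha i - b) a 1.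
have gxy : g x = g y by rewrite /g !expsum_shift !comp_polyC ax ay !mulr0.
have gd t : derivable g t 1 by exact: derivable_expsum.
have [//||c] := @Rolle R g x y xy _ _ gxy; first exact: derivable_within_continuous.
rewrite in_itv /= => cxy [_ gc0]; exists c => //.
have [_] := is_derive_expsum (fun i => alpha i - b) a 1 c.
rewrite gc0 mulr1 expsum_shift comp_polyX => /esym/eqP.
by rewrite mulf_eq0 gt_eqF ?expR_gt0 //= => /eqP.
Qed.

(** * The rule of signs as a bound on the number of roots *)

Section Descartes.
Context {R : realType} {I : finType} (alpha : I -> R).
Implicit Types (a : I -> R) (s bs : seq R) (b x : R).

(** Consecutive distinct roots contribute a new root between them and repeated ones
    lose one order.  The last two conclusions make the induction on the sorted
    list work: they bound the multiplicity of the head in the new list. *)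
Lemma rolle_vanishes a b x s : path <=%R x s -> vanishes alpha a (x :: s) ->
  exists s', [/\ size s' = size s,
    vanishes alpha (fun i => a i * (alpha i - b)) s',
    all (fun y => x <= y) s' &
    (count_mem x s' < count_mem x (x :: s))%N].
Proof.
elim: s x => [|y s IHs] x /=.
  move=> _ _; exists [::]; split=> //=; last by rewrite eqxx.
  move=> z q; rewrite leqn0 size_poly_eq0 => /eqP ->.
  by rewrite -[0](scale0r 1) expsumZr mul0r.
move=> /andP[le_xy sorted_ys] van.
have van_ys : vanishes alpha a (y :: s).
  by apply: vanishes_sub van => z /=; rewrite leq_addl.
have [t [size_t van_t ge_t count_t]] := IHs y sorted_ys van_ys.
have ge_t' : all (fun u => x <= u) t.
  by apply: sub_all ge_t => u; exact: le_trans.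
have [eq_xy|neq_xy] := eqVneq x y.
  subst y; exists (x :: t); split; rewrite /= ?size_t ?lexx //.
    move=> z q /=; have [<-|_] := eqVneq x z; last by rewrite add0n; exact: van_t.
    move=> le_q; rewrite expsum_mul_root; apply: van => /=.
    rewrite (leq_trans (size_polyMleq _ _)) // size_XsubC /= eqxx add1n ltnS.
    by rewrite (leq_trans le_q) // add1n; move: count_t; rewrite /= eqxx.
  by move: count_t; rewrite /= eqxx !add1n ltnS.
have lt_xy : x < y by rewrite lt_neqAle neq_xy.
have root_of z : z \in [:: x, y & s] -> expsum alpha a 1 z = 0.
  by move=> z_in; apply: van; rewrite size_poly1 -has_count has_pred1.
have x0 : expsum alpha a 1 x = 0 by rewrite root_of // !inE eqxx.
have y0 : expsum alpha a 1 y = 0 by rewrite root_of // !inE eqxx orbT.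
have [c /andP[lt_xc lt_cy] c0] := rolle_expsum b lt_xy x0 y0.
have count0 u : u < y -> count_mem u t = 0%N.
  move=> lt_uy; apply/count_memPn/negP => /(allP ge_t).
  by rewrite leNgt lt_uy.
exists (c :: t); split; rewrite /= ?size_t ?(ltW lt_xc) //; last first.
  by rewrite count0 // gt_eqF //= eqxx.
move=> z q /=; have [<-|_] := eqVneq c z; last by rewrite add0n; exact: van_t.
rewrite count0 // addn0 => /size1_polyC ->.
by rewrite -[_%:P]mulr1 mul_polyC expsumZr expsum_mul_root mulr1 c0 mulr0.
Qed.

(** Each step of [rolle_vanishes] uses up one element b of bs and one root; when bs
    is exhausted the coefficients have one sign and there is no root left.  The
    hypothesis on products leaves this sign unspecified, so that the lemma applies to
    coefficients known up to a common factor. *)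
Lemma descartes_bound a s bs : vanishes alpha a s ->
  (forall i j, 0 <= (a i * \prod_(b <- bs) (alpha i - b)) *
                    (a j * \prod_(b <- bs) (alpha j - b))) ->
  (exists i, a i * \prod_(b <- bs) (alpha i - b) != 0) ->
  (size s <= size bs)%N.
Proof.
elim: bs a s => [|b bs IHbs] a s van same_sign [i0 nz].
  case: s van => // z s van.
  have {}same_sign i j : 0 <= a i * a j.
    by have := same_sign i j; rewrite !big_nil !mulr1.
  rewrite big_nil mulr1 in nz.
  have : 0 < a i0 * expsum alpha a 1 z.
    rewrite /expsum mulr_sumr (bigD1 i0) //= ltr_wpDr ?sumr_ge0 //.
      by move=> i _; rewrite hornerC mulr1 mulrA mulr_ge0 ?expR_ge0.
    by rewrite hornerC mulr1 mulrA mulr_gt0 ?expR_gt0 // lt_def mulf_neq0 ?same_sign.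
  by rewrite van ?mulr0 ?ltxx // size_poly1 /= eqxx.
have van_sort : vanishes alpha a (sort <=%R s).
  by apply: vanishes_sub van => z; apply/eq_leq/permP; rewrite perm_sort.
rewrite -(size_sort <=%R s); have := sort_sorted le_total s.
case: (sort <=%R s) van_sort => //= x s1 van1 sorted1.
have [s' [size_s' van_s' _ _]] := rolle_vanishes b sorted1 van1.
rewrite ltnS -size_s'; apply: IHbs van_s' _ _; last first.
  by exists i0; move: nz; rewrite big_cons mulrA.
by move=> i j; have := same_sign i j; rewrite !big_cons !mulrA.
Qed.

End Descartes.

(** * Interpolation: exponential sums with as many roots as possible *)

Section Interpolation.
Context {R : realType} {I : finType} (alpha : I -> R).
Implicit Types (a : I -> R) (s : seq R) (S T : {set I}).

(** There are fewer linear conditions than coefficients, one condition for each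
    element of s counted with its multiplicity. *)
Lemma exists_vanishing S s : (size s < #|S|)%N ->
  exists a, [/\ forall i, i \notin S -> a i = 0, exists i, a i != 0 &
    vanishes alpha a s].
Proof.
(* The pair (z, j) stands for the vanishing at z of the j-th derivative. *)
pose conds := fix conds (u : seq R) :=
  if u is z :: u' then (z, count_mem z u') :: conds u' else [::].
have size_conds u : size (conds u) = size u by elim: u => //= z u ->.
have mem_conds u z j : (j < count_mem z u)%N -> (z, j) \in conds u.
  elim: u => //= y u IHu; rewrite inE xpair_eqE eq_sym.
  have [<-|_] := eqVneq z y; last by rewrite add0n => /IHu.
  by rewrite add1n ltnS leq_eqVlt => /predU1P[->|/IHu ->]; rewrite ?eqxx ?orbT.
move=> lt_sS; pose c l := nth (0, 0%N) (conds s) l.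
pose g i (zj : R * nat) := alpha i ^+ zj.2 * expR (alpha i * zj.1).
pose A := \matrix_(k < #|S|, l < size s) g (enum_val k) (c l).
have : kermx A != 0.
  rewrite kermx_eq0 -row_leq_rank -ltnNge.
  exact: leq_ltn_trans (rank_leq_col A) lt_sS.
case/rowV0Pn => v /sub_kermxP vA v_neq0.
pose a i := \sum_k v 0 k *+ (enum_val k == i).
have aE k : a (enum_val k) = v 0 k.
  rewrite /a (bigD1 k) //= eqxx mulr1n big1 ?addr0 // => k' neq_k.
  by rewrite (inj_eq enum_val_inj) (negPf neq_k).
exists a; split.
- move=> i iS; rewrite /a big1 // => k _.
  by have [ki|//] := eqVneq (enum_val k) i; rewrite -ki enum_valP in iS.
- have [k vk] := matrix0Pn _ v_neq0; case: vk => k' vk'.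
  by exists (enum_val k'); rewrite aE; rewrite ord1 in vk'.
move=> z; apply: (expsum_basis (P := fun j => 'X^j)); first exact: size_polyXn.
move=> j /mem_conds /(nthP (0, 0%N)) [l lt_l cl].
rewrite size_conds in lt_l.
have /matrixP/(_ 0 (Ordinal lt_l)) := vA.
rewrite !mxE => <-; rewrite /expsum.
under eq_bigr => i _ do rewrite /a !mulr_suml.
rewrite exchange_big /=; apply: eq_bigr => k _.
rewrite (bigD1 (enum_val k)) //= eqxx mulr1n big1 ?addr0.
  by rewrite mxE /c /= cl /g /= hornerXn mulrA.
by move=> i /negPf neq_i; rewrite eq_sym neq_i mulr0n !mul0r.
Qed.

Definition nodal T i : R := \prod_(l in T) (alpha i - alpha l).

Lemma descartes_nodal T a s : vanishes alpha a s ->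
  (forall i j, 0 <= (a i * nodal T i) * (a j * nodal T j)) ->
  (exists i, a i * nodal T i != 0) -> (size s <= #|T|)%N.
Proof.
pose bs := [seq alpha l | l <- enum T].
have bsE i : \prod_(b <- bs) (alpha i - b) = nodal T i by rewrite big_map big_enum.
move=> van same_sign [i nz]; have -> : #|T| = size bs by rewrite size_map -cardE.
apply: (descartes_bound van) => [j l|]; first by rewrite !bsE.
by exists i; rewrite bsE.
Qed.

Context (alpha_inj : injective alpha).

Lemma nodal_eq0 T i : (nodal T i == 0) = (i \in T).
Proof.
apply/idP/idP => [|iT]; last by rewrite /nodal (bigD1 i) //= subrr mul0r.
apply: contraTT => iT; apply/prodf_neq0 => l lT.
by rewrite subr_eq0 (inj_eq alpha_inj); apply: contraNneq iT => ->.
Qed.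

(** Exponentials form a Chebyshev system.  Killing all terms of S but one by the
    factors [alpha i - alpha l] leaves a sum without roots. *)
Lemma support_bound S a s : (forall i, i \notin S -> a i = 0) ->
  (exists i, a i != 0) -> vanishes alpha a s -> (size s < #|S|)%N.
Proof.
move=> supp_a [i ai] van.
have iS : i \in S by apply: contraNT ai => /supp_a ->.
have killed m : m != i -> a m * nodal (S :\ i) m = 0.
  move=> neq; have [mS|/supp_a ->] := boolP (m \in S); last by rewrite mul0r.
  by apply/eqP; rewrite mulf_eq0 nodal_eq0 !inE neq mS orbT.
rewrite (cardsD1 i S) iS add1n ltnS; apply: (descartes_nodal van).
  move=> m m'; have [->|/killed ->] := eqVneq m i; last by rewrite mul0r.
  have [->|/killed ->] := eqVneq m' i; last by rewrite mulr0.
  by rewrite -expr2 sqr_ge0.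
by exists i; rewrite mulf_neq0 // nodal_eq0 !inE eqxx.
Qed.

(** The coefficients of an interpolant on S are, up to one common sign, those of
    the products [nodal (S :\ i) i], which alternate when S is sorted.  Otherwise,
    killing all terms but those of i and j would leave two terms of the same sign,
    and one root too many. *)
Lemma interpolant_signs S a s : #|S| = (size s).+1 ->
  (forall i, i \notin S -> a i = 0) -> (exists i, a i != 0) ->
  vanishes alpha a s -> forall i j, i \in S -> j \in S ->
  0 < (a i * nodal (S :\ i) i) * (a j * nodal (S :\ j) j).
Proof.
move=> cardS supp_a nz van.
have a_neq0 i : i \in S -> a i != 0.
  move=> iS; apply/eqP => ai0.
  have : (size s < #|S :\ i|)%N.
    apply: support_bound nz van => m; rewrite !inE negb_and negbK.
    by case/orP => [/eqP -> //|/supp_a].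
  by move: cardS; rewrite (cardsD1 i S) iS add1n => -[->]; rewrite ltnn.
move=> i j iS jS; have [<-|neq_ij] := eqVneq i j.
  by rewrite -expr2 exprn_even_gt0 //= mulf_neq0 ?a_neq0 // nodal_eq0 !inE eqxx.
rewrite ltNge; apply/negP => le0; pose T := S :\ i :\ j.
have nodal_i : nodal (S :\ i) i = (alpha i - alpha j) * nodal T i.
  rewrite /nodal (bigD1 j) /= ?inE ?jS 1?eq_sym ?neq_ij //.
  by congr (_ * _); apply: eq_bigl => l; rewrite !inE andbC.
have nodal_j : nodal (S :\ j) j = (alpha j - alpha i) * nodal T j.
  rewrite /nodal (bigD1 i) /= ?inE ?iS ?neq_ij //.
  congr (_ * _); apply: eq_bigl => l; rewrite !inE.
  by case: (l == i); case: (l == j); rewrite ?andbF ?andbT.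
have killed m : a m * nodal T m != 0 -> (m == i) || (m == j).
  apply: contraNT; rewrite negb_or => /andP[mi mj].
  have [mS|/supp_a ->] := boolP (m \in S); last by rewrite mul0r.
  by rewrite mulf_eq0 nodal_eq0 !inE mi mj mS orbT.
have ij_ge0 : 0 <= (a i * nodal T i) * (a j * nodal T j).
  move: le0; rewrite nodal_i nodal_j.
  have -> : a i * ((alpha i - alpha j) * nodal T i) *
      (a j * ((alpha j - alpha i) * nodal T j)) =
      - ((alpha i - alpha j) ^+ 2 * (a i * nodal T i * (a j * nodal T j))) by ring.
  rewrite oppr_le0 pmulr_rge0 // exprn_even_gt0 //= subr_eq0.
  by rewrite (inj_eq alpha_inj).
have : (size s <= #|T|)%N.
  apply: (descartes_nodal van) => [m m'|].
    have [->|/killed mE] := eqVneq (a m * nodal T m) 0; first by rewrite mul0r.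
    have [->|/killed mE'] := eqVneq (a m' * nodal T m') 0; first by rewrite mulr0.
    by case/orP: mE mE' => /eqP -> /orP[] /eqP ->; rewrite -?expr2 ?sqr_ge0 // mulrC.
  by exists i; rewrite mulf_neq0 ?a_neq0 // nodal_eq0 !inE eqxx andbF.
have := cardsD1 i S; rewrite iS cardS add1n => -[->].
by rewrite (cardsD1 j (S :\ i)) !inE eq_sym neq_ij jS add1n ltnn.
Qed.

End Interpolation.

Lemma signed_prod_gt0 (R : realDomainType) (J : finType) (P : pred J)
    (e : J -> nat) (F : J -> R) : (forall c, P c -> 0 < (-1) ^+ e c * F c) ->
  0 < (-1) ^+ (\sum_(c | P c) e c)%N * \prod_(c | P c) F c.
Proof. by move=> F_gt0; rewrite expr_sum -big_split prodr_gt0. Qed.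

(** There are [q - c] negative factors in this product. *)
Lemma nodal_sign (R : realType) (I : finType) (alpha : I -> R) (q : nat)
    (g : 'I_q.+1 -> I) (c : 'I_q.+1) :
  (forall c1 c2 : 'I_q.+1, (c1 < c2)%N -> alpha (g c1) < alpha (g c2)) ->
  0 < (-1) ^+ (c + q) * nodal alpha ([set g c' | c' : 'I_q.+1] :\ g c) (g c).
Proof.
move=> g_incr; pose S := [set g c' | c' : 'I_q.+1]; rewrite -/S.
have g_inj : injective g.
  move=> c1 c2 eq_g; apply: val_inj.
  by case: (ltngtP c1 c2) => // /g_incr; rewrite eq_g ltxx.
have in_S i : (i \in S) = (i \in codom g).
  by apply/imsetP/codomP => [[c' _ ->]|[c' ->]]; exists c'.
have -> : nodal alpha (S :\ g c) (g c) =
    \prod_(c' | c' != c) (alpha (g c) - alpha (g c')).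
  rewrite /nodal (eq_bigl (fun i => i \in [set g c' | c' in [set~ c]])).
    rewrite big_imset /=; last by move=> x y _ _; exact: g_inj.
    by apply: eq_bigl => c'; rewrite !inE.
  move=> i; rewrite !inE in_S; apply/andP/imsetP => [[neq /codomP[c' ic']]|[c' c'c ->]].
    by exists c' => //; rewrite !inE; apply: contraNneq neq => <-; rewrite ic'.
  by rewrite (inj_eq g_inj) codom_f; move: c'c; rewrite !inE.
(* The factor of c' has the sign (-1)^([c' < c] + 1). *)
have -> : (c + q = \sum_(c' : 'I_q.+1 | c' != c) (c' < c).+1)%N.
  transitivity (\sum_(c' : 'I_q.+1 | c' != c) (c' < c) +
                \sum_(c' : 'I_q.+1 | c' != c) 1)%N; last first.
    by rewrite -big_split; apply: eq_bigr => c' _ /=; rewrite addn1.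
  congr (_ + _)%N; last first.
    by rewrite sum1_card; have := cardC1 c; rewrite card_ord /=.
  have -> : (\sum_(c' : 'I_q.+1 | c' != c) (c' < c) = \sum_(c' < q.+1) (c' < c))%N.
    by rewrite [RHS](bigD1 c) //= ltnn.
  rewrite (eq_bigr (fun c' : 'I_q.+1 => if (c' < c)%N then 1%N else 0%N)); last first.
    by move=> c' _; case: ifP.
  rewrite -big_mkcond -(big_ord_widen q.+1 (fun=> 1%N)) /=; last exact: ltnW.
  by rewrite sum1_card card_ord.
apply: signed_prod_gt0 => c' neq; rewrite exprS.
case: (ltngtP c' c) => [lt_c|gt_c|/val_inj eq_c]; last by rewrite eq_c eqxx in neq.
  have : alpha (g c') < alpha (g c) by exact: g_incr.
  by rewrite expr1; lra.
have : alpha (g c) < alpha (g c') by exact: g_incr.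
by rewrite expr0; lra.
Qed.

(** * Dividing an exponential sum by its roots *)

Lemma same_sign_trans (R : realDomainType) (x y z : R) :
  0 < x * y -> 0 < z * y -> 0 < x * z.
Proof.
move=> xy zy; have y_neq0 : y != 0 by apply: contraTneq xy => ->; rewrite mulr0 ltxx.
rewrite -(pmulr_lgt0 (x := y ^+ 2)); first by have := mulr_gt0 xy zy; rewrite mulrACA.
by rewrite exprn_even_gt0.
Qed.

Section Quotient.
Context {R : realType} {I : finType} (alpha : I -> R).
Local Open Scope classical_set_scope.
Implicit Types (a : I -> R) (q : {poly R}) (s : seq R) (r t : R).

Lemma is_derive_exprB n (t0 t : R) :
  is_derive t 1 (fun x : R => (x - t0) ^+ n.+1) (n.+1%:R * (t - t0) ^+ n).
Proof.
have h : is_derive t 1 (fun x : R => x - t0) 1.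
  rewrite -[X in is_derive _ _ _ X]subr0.
  exact: (@is_deriveB R R^o R^o id (cst t0) t 1 1 0 _ _).
have -> : (fun x : R => (x - t0) ^+ n.+1) = (fun x : R => x - t0) ^+ n.+1.
  by apply/funext => x; rewrite exprfctE.
rewrite -[X in is_derive _ _ _ X]mulr1.
exact: (@is_deriveX R R^o (fun x => x - t0) n.+1 t 1 1 h).
Qed.

(** Taylor's formula at order m, by m applications of L'Hopital's rule, taken on each
    side since the quotients are meaningless at t0 itself. *)
Lemma cvg_expsum_div a (t0 : R) m q :
  (forall j, (j < m)%N -> expsum alpha a ('X^j * q) t0 = 0) ->
  expsum alpha a q t / (t - t0) ^+ m @[t --> t0^'] -->
  expsum alpha a ('X^m * q) t0 / m`!%:R.
Proof.
elim: m q => [|m IHm] q van0.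
  rewrite mul1r fact0 divr1; under eq_fun do rewrite expr0 divr1.
  exact/continuous_withinNx/continuous_expsum.
have lim' : expsum alpha a ('X * q) t / (m.+1%:R * (t - t0) ^+ m) @[t --> t0^'] -->
    expsum alpha a ('X^(m.+1) * q) t0 / (m.+1)`!%:R.
  have -> : expsum alpha a ('X^(m.+1) * q) t0 / (m.+1)`!%:R =
      m.+1%:R^-1 * (expsum alpha a ('X^m * ('X * q)) t0 / m`!%:R).
    by rewrite exprSr -mulrA factS natrM invfM; ring.
  under eq_fun do rewrite invfM mulrCA.
  apply: cvgMr; apply: IHm => j lt_jm.
  by rewrite mulrA -exprSr; exact: van0.
have num0 : expsum alpha a q t @[t --> t0] --> (0 : R).
  have := @continuous_expsum R I alpha a q t0.
  by rewrite /continuous_at -[expsum _ _ _ t0](_ : 0 = _) // -(van0 0%N) ?mul1r.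
have den_cont : {for t0, continuous (fun t => (t - t0) ^+ m.+1)}.
  apply/differentiable_continuous; rewrite -derivable1_diffP.
  by case: (is_derive_exprB m t0 t0).
have den0 : (t - t0) ^+ m.+1 @[t --> t0] --> (0 : R).
  have : (t - t0) ^+ m.+1 @[t --> t0] --> (t0 - t0) ^+ m.+1 := den_cont.
  by rewrite subrr expr0n.
apply: (@cvg_at_right_left_dnbhs R R^o).
- apply: (@lhopital_at_right R (expsum alpha a q) (expsum alpha a ('X * q))
    (fun t => (t - t0) ^+ m.+1) (fun t => m.+1%:R * (t - t0) ^+ m) t0 (t0 + 1)).
  + by rewrite ltrDl.
  + by move=> t _; exact: is_derive_expsum.
  + by move=> t _; exact: is_derive_exprB.
  + exact/cvg_at_right_filter.
  + exact/cvg_at_right_filter.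
  + move=> t; rewrite in_itv /= => /andP[lt_t _].
    by rewrite mulf_neq0 ?pnatr_eq0 // expf_neq0 // subr_eq0 gt_eqF.
  + exact: cvg_dnbhs_at_right.
- apply: (@lhopital_at_left R (expsum alpha a q) (expsum alpha a ('X * q))
    (fun t => (t - t0) ^+ m.+1) (fun t => m.+1%:R * (t - t0) ^+ m) (t0 - 1) t0).
  + by rewrite gtrBl.
  + by move=> t _; exact: is_derive_expsum.
  + by move=> t _; exact: is_derive_exprB.
  + exact/cvg_at_left_filter.
  + exact/cvg_at_left_filter.
  + move=> t; rewrite in_itv /= => /andP[_ lt_t].
    by rewrite mulf_neq0 ?pnatr_eq0 // expf_neq0 // subr_eq0 lt_eqF.
  + exact: cvg_dnbhs_at_left.
Qed.

(** If [vanishes alpha a s], the continuous extension to the points of s of the quotient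
    of [expsum alpha a 1 t] by the product of the [t - y] for y in s.  At a point of
    multiplicity m in s, the m zero factors of the denominator are replaced by m!
    and the numerator by its m-th derivative. *)
Definition quotient a s t : R :=
  expsum alpha a 'X^(count_mem t s) t /
  ((count_mem t s)`!%:R * \prod_(y <- s | y != t) (t - y)).

Lemma quotient_notin a s t : t \notin s ->
  quotient a s t = expsum alpha a 1 t / \prod_(y <- s) (t - y).
Proof.
move=> ts; rewrite /quotient (count_memPn ts) fact0 mul1r expr0.
congr (_ / _); rewrite big_seq_cond [RHS]big_seq_cond; apply: eq_bigl => y.
by have [ys|//] := boolP (y \in s); apply: contraNneq ts => <-.
Qed.

Lemma quotient_eq0 a s t :
  (quotient a s t == 0) = (expsum alpha a 'X^(count_mem t s) t == 0).
Proof.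
rewrite /quotient mulf_eq0 invr_eq0 [X in _ || X](_ : _ = false) ?orbF //.
apply: negbTE; rewrite mulf_neq0 ?pnatr_eq0 -?lt0n ?fact_gt0 // prodf_seq_neq0.
by apply/allP => y _ /=; apply/implyP => neq; rewrite subr_eq0 eq_sym.
Qed.

Lemma quotient_suml (J : finType) (a : J -> I -> R) s t :
  quotient (fun i => \sum_j a j i) s t = \sum_j quotient (a j) s t.
Proof. by rewrite /quotient expsum_suml mulr_suml. Qed.

(** If d is positive, both sides vanish at r, the left one since r is a root outside
    s.  Elsewhere the two denominators differ by the factor (t - r)^d. *)
Lemma quotient_cat_nseq a s d r t : r \notin s ->
  vanishes alpha a (nseq d r ++ s) ->
  quotient a s t = quotient a (nseq d r ++ s) t * (t - r) ^+ d.
Proof.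
move=> rs van; have [->|d_gt0] := posnP d; first by rewrite expr0 mulr1.
have [->|neq] := eqVneq t r.
  rewrite subrr expr0n gtn_eqF // mulr0 quotient_notin // van ?mul0r //.
  by rewrite size_poly1 count_cat count_nseq /= eqxx mul1n addn_gt0 d_gt0.
rewrite /quotient count_cat count_nseq /= eq_sym (negPf neq) mul0n add0n.
rewrite big_cat big_nseq_cond eq_sym neq /= iter_mulr_1.
have : (t - r) ^+ d != 0 by rewrite expf_neq0 // subr_eq0.
move: ((t - r) ^+ d) => x x0.
rewrite -[LHS]mulr1 -(mulVf x0) !invfM; ring.
Qed.

Lemma near_notin s (t0 : R) : \forall t \near t0^', t \notin s.
Proof.
elim: s => [|y s IHs]; first by near=> t.
near=> t; rewrite inE negb_or; apply/andP; split; last by near: t.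
near: t; have [<-|neq] := eqVneq t0 y; first exact: nbhs_dnbhs_neq.
by apply: nbhs_dnbhs; exact: open_neq.
Unshelve. all: by end_near. Qed.

Lemma continuous_quotient a s : vanishes alpha a s -> continuous (quotient a s).
Proof.
move=> van t0; apply/continuous_withinNx.
set m := count_mem t0 s.
pose p : {poly R} := \prod_(y <- s | y != t0) ('X - y%:P).
have pE t : p.[t] = \prod_(y <- s | y != t0) (t - y).
  by rewrite horner_prod; apply: eq_bigr => y _; rewrite hornerXsubC.
have p0 : p.[t0] != 0.
  rewrite pE prodf_seq_neq0; apply/allP => y _ /=.
  by apply/implyP => neq; rewrite subr_eq0 eq_sym.
have -> : quotient a s t0 = expsum alpha a ('X^m * 1) t0 / m`!%:R * p.[t0]^-1.
  by rewrite /quotient mulr1 invfM mulrA pE.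
apply: (@cvg_trans _ ((expsum alpha a 1 t / (t - t0) ^+ m * p.[t]^-1) @[t --> t0^'])).
  apply: near_eq_cvg; near=> t.
  have ts : t \notin s by near: t; exact: near_notin.
  rewrite quotient_notin // (bigID (fun y => y == t0)) /= invfM mulrA pE.
  congr (_ / _ / _); rewrite (eq_bigr (fun=> t - t0)) => [|y /eqP -> //].
  by rewrite big_const_seq iter_mulr_1.
apply: cvgM.
  apply: cvg_expsum_div => j lt_jm; rewrite mulr1; apply: van.
  by rewrite size_polyXn.
apply: cvgV => //; apply/continuous_withinNx.
exact: continuous_horner.
Unshelve. all: by end_near. Qed.

Lemma quotient_same_sign a s : vanishes alpha a s -> (forall t, quotient a s t != 0) ->
  forall t u, 0 < quotient a s t * quotient a s u.
Proof.
move=> van neq0.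
suff H t u : t <= u -> 0 < quotient a s t * quotient a s u.
  by move=> t u; case: (leP t u) => [|/ltW] /H //; rewrite mulrC.
move=> le_tu; rewrite ltNge; apply/negP => le0.
have cont : {within `[t, u], continuous (quotient a s)}.
  exact/continuous_subspaceT/continuous_quotient.
have [|c _ /eqP] := @IVT R (quotient a s) t u 0 le_tu cont; last first.
  by rewrite (negPf (neq0 c)).
rewrite ge_min le_max; move: le0 (neq0 t) (neq0 u).
move: (quotient a s t) (quotient a s u) => x y le0 x0 y0.
by case: (ltrgt0P x) x0 => // hx _; case: (ltrgt0P y) y0 => // hy _; nra.
Qed.

Lemma expsum_pinfty a i0 :
  (forall i, i != i0 -> a i != 0 -> alpha i < alpha i0) -> a i0 != 0 ->
  exists T, forall t, T < t -> 0 < a i0 * expsum alpha a 1 t.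
Proof.
move=> max_i0 nz.
(* The lower terms are bounded through expR (- d * t) <= 1 / (d * t), d > 0. *)
pose C := \sum_(i | i != i0) `|a i| / (alpha i0 - alpha i).
have C_ge0 : 0 <= C.
  apply: sumr_ge0 => i /max_i0.
  have [->|_ /(_ isT) lt_i] := eqVneq (a i) 0; first by rewrite normr0 mul0r.
  by rewrite divr_ge0 // subr_ge0 ltW.
exists (C / `|a i0|) => t lt_t.
have a_gt0 : 0 < `|a i0| by rewrite normr_gt0.
have t_gt0 : 0 < t by apply: le_lt_trans lt_t; rewrite divr_ge0.
have -> : a i0 * expsum alpha a 1 t = expR (alpha i0 * t) * (a i0 * a i0 +
    \sum_(i | i != i0) a i0 * a i * expR ((alpha i - alpha i0) * t)).
  rewrite /expsum (bigD1 i0) //= hornerC mulr1 !mulrDr mulrA mulrC; congr (_ + _).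
  rewrite !mulr_sumr; apply: eq_bigr => i _.
  rewrite hornerC mulr1 [in RHS]mulrCA -expRD -mulrA; congr (_ * (_ * expR _)); ring.
rewrite mulr_gt0 ?expR_gt0 //; set S := \sum_(i | _) _.
suff : `|S| < `|a i0| ^+ 2.
  rewrite real_normK ?num_real // expr2 ltr_norml => /andP[+ _].
  by rewrite -subr_gt0 opprK addrC.
have : `|S| <= `|a i0| * (C / t).
  rewrite (le_trans (ler_norm_sum _ _ _)) // /C mulr_suml mulr_sumr.
  apply: ler_sum => i /max_i0.
  have [->|_ /(_ isT) lt_i] := eqVneq (a i) 0.
    by rewrite mulr0 mul0r normr0 !mul0r mulr0.
  rewrite !normrM -!mulrA ler_pM2l // ler_wpM2l // ger0_norm ?expR_ge0 //.
  rewrite -invfM -opprB mulNr expRN lef_pV2 ?posrE ?expR_gt0 ?mulr_gt0 ?subr_gt0 //.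
  by rewrite (le_trans _ (expR_ge1Dx _)) // lerDr.
move=> /le_lt_trans; apply; rewrite expr2 ltr_pM2l //.
by rewrite ltr_pdivrMr // mulrC -ltr_pdivrMr.
Qed.

End Quotient.

Section QuotientSign.
Context {R : realType} {I : finType} (alpha : I -> R).
Implicit Types (a : I -> R) (s : seq R) (t : R).

Lemma expsum_minfty a i0 :
  (forall i, i != i0 -> a i != 0 -> alpha i0 < alpha i) -> a i0 != 0 ->
  exists T, forall t, t < T -> 0 < a i0 * expsum alpha a 1 t.
Proof.
move=> min_i0 nz.
have [|T HT] := @expsum_pinfty R I (fun i => - alpha i) a i0 _ nz.
  by move=> i; rewrite ltrN2; exact: min_i0.
exists (- T) => t lt_t; have := HT (- t); rewrite ltrNr => /(_ lt_t).
rewrite /expsum (eq_bigr (fun i => a i * 1.[alpha i] * expR (alpha i * t))) // => i _.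
by rewrite !hornerC mulrNN.
Qed.

Lemma quotient_sign_max a s i0 : vanishes alpha a s ->
  (forall t, quotient alpha a s t != 0) ->
  (forall i, i != i0 -> a i != 0 -> alpha i < alpha i0) -> a i0 != 0 ->
  forall t, 0 < a i0 * quotient alpha a s t.
Proof.
move=> van neq0 max_i0 nz t.
have [T HT] := expsum_pinfty max_i0 nz.
pose u := `|T| + \sum_(y <- s) `|y| + 1.
have lt_u y : y \in s -> y < u.
  move=> ys; rewrite /u (big_rem y ys) /=.
  have := ler_norm y; have : 0 <= \sum_(z <- rem y s) `|z| by apply: sumr_ge0.
  have := normr_ge0 T; lra.
have us : u \notin s by apply/negP => /lt_u; rewrite ltxx.
have lt_Tu : T < u.
  rewrite /u; have := ler_norm T; have : 0 <= \sum_(y <- s) `|y| by apply: sumr_ge0.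
  lra.
have P_gt0 : 0 < \prod_(y <- s) (u - y).
  by rewrite big_seq; apply: prodr_gt0 => y /lt_u; rewrite subr_gt0.
have u_gt0 : 0 < a i0 * quotient alpha a s u.
  by rewrite quotient_notin // mulrA divr_gt0 // HT.
exact: same_sign_trans u_gt0 (quotient_same_sign van neq0 t u).
Qed.

Lemma quotient_sign_min a s i0 : vanishes alpha a s ->
  (forall t, quotient alpha a s t != 0) ->
  (forall i, i != i0 -> a i != 0 -> alpha i0 < alpha i) -> a i0 != 0 ->
  forall t, 0 < (-1) ^+ size s * a i0 * quotient alpha a s t.
Proof.
move=> van neq0 min_i0 nz t.
have [T HT] := expsum_minfty min_i0 nz.
pose u := - (`|T| + \sum_(y <- s) `|y| + 1).
have lt_u y : y \in s -> u < y.
  move=> ys; rewrite /u (big_rem y ys) /=.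
  have := ler_norm (- y); have : 0 <= \sum_(z <- rem y s) `|z| by apply: sumr_ge0.
  have := normr_ge0 T; rewrite normrN; lra.
have us : u \notin s by apply/negP => /lt_u; rewrite ltxx.
have lt_uT : u < T.
  rewrite /u; have := ler_norm (- T); have : 0 <= \sum_(y <- s) `|y| by apply: sumr_ge0.
  rewrite normrN; lra.
have P_gt0 : 0 < (-1) ^+ size s * \prod_(y <- s) (u - y).
  have -> : (-1) ^+ size s * \prod_(y <- s) (u - y) = \prod_(y <- s) (y - u).
    rewrite -[in (-1) ^+ _](count_predT s) -iter_mulr_1 -big_const_seq -big_split /=.
    by apply: eq_bigr => y _; rewrite mulN1r opprB.
  by rewrite big_seq; apply: prodr_gt0 => y /lt_u; rewrite subr_gt0.
have u_gt0 : 0 < (-1) ^+ size s * a i0 * quotient alpha a s u.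
  rewrite quotient_notin //.
  have -> : (-1) ^+ size s * a i0 * (expsum alpha a 1 u / \prod_(y <- s) (u - y)) =
      a i0 * expsum alpha a 1 u / ((-1) ^+ size s * \prod_(y <- s) (u - y)).
    by rewrite invfM -exprVn invrN1; ring.
  by rewrite divr_gt0 ?HT.
exact: same_sign_trans u_gt0 (quotient_same_sign van neq0 t u).
Qed.

End QuotientSign.

(** * Blocks of constant sign *)

Section Blocks.
Context {R : realType} {n : nat} (sigma : 'I_n.+1 -> R).
Implicit Types (i j : 'I_n.+1) (v : 'I_n) (c : nat).

Definition variation_at v := sigma (widen_ord (leqnSn n) v) == - sigma (lift ord0 v).

(** The number of sign variations before i, which numbers the maximal runs of equal
    signs. *)
Definition block i : nat := (\sum_(v | variation_at v) (v < i))%N.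

Lemma ord_step_ind (P : 'I_n.+1 -> Prop) : P ord0 ->
  (forall v : 'I_n, P (widen_ord (leqnSn n) v) -> P (lift ord0 v)) -> forall i, P i.
Proof.
move=> P0 PS [m lt_m]; elim: m lt_m => [|m IHm] lt_m.
  by rewrite (_ : Ordinal _ = ord0) //; exact: val_inj.
rewrite (_ : Ordinal _ = lift ord0 (Ordinal (lt_m : (m < n)%N))); last first.
  exact: val_inj.
apply: PS; rewrite (_ : widen_ord _ _ = Ordinal (ltnW lt_m)); first exact: IHm.
exact: val_inj.
Qed.

Lemma block0 : block ord0 = 0%N.
Proof. by rewrite /block big1. Qed.

Lemma block_max : block ord_max = sign_variations sigma.
Proof.
rewrite /block /sign_variations -sum1_card.
by apply: eq_big => v; rewrite ?inE // => _; rewrite /= ltn_ord.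
Qed.

Lemma block_lift v :
  block (lift ord0 v) = (block (widen_ord (leqnSn n) v) + variation_at v)%N.
Proof.
have -> : nat_of_bool (variation_at v) = (\sum_(u | variation_at u) (u == v))%N.
  rewrite big_mkcond (bigD1 v) //= eqxx big1 ?addn0 => [|u /negPf ->]; by case: ifP.
rewrite /block -big_split; apply: eq_bigr => u _ /=.
rewrite /bump /= add1n ltnS leq_eqVlt -val_eqE /=.
by case: ltngtP.
Qed.

Lemma leq_block i j : (i <= j)%N -> (block i <= block j)%N.
Proof.
move=> le_ij; apply: leq_sum => v _; case: ltnP => // lt_vi.
by rewrite (leq_trans lt_vi le_ij).
Qed.

Lemma block_onto c : (c <= sign_variations sigma)%N -> exists i, block i = c.
Proof.
rewrite -block_max; elim/ord_step_ind: ord_max c => [c|v IHv c].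
  by rewrite block0 leqn0 => /eqP ->; exists ord0; exact: block0.
rewrite leq_eqVlt => /predU1P[->|]; first by exists (lift ord0 v).
rewrite block_lift => lt_c; apply: IHv; move: lt_c.
by case: variation_at; rewrite ?addn1 ?addn0 ?ltnS // => /ltnW.
Qed.

Lemma sigma_block (sigma_sign : forall i, sigma i = 1 \/ sigma i = -1) i :
  sigma i = (-1) ^+ block i * sigma ord0.
Proof.
elim/ord_step_ind: i => [|v IHv]; first by rewrite block0 mul1r.
rewrite block_lift exprD mulrAC -IHv /variation_at.
case: eqP => [->|]; first by rewrite mulrN1 opprK.
move: (sigma_sign (widen_ord (leqnSn n) v)) (sigma_sign (lift ord0 v)).
by move=> [] -> [] -> //; rewrite ?opprK ?mulr1.
Qed.

End Blocks.

(** * Signs and exact root multisets of exponential sums *)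

Section Existence.
Context {R : realType} {n : nat} (alpha sigma : 'I_n.+1 -> R).
Context (alpha_incr : forall i j : 'I_n.+1, (i < j)%N -> alpha i < alpha j).
Context (sigma_sign : forall i : 'I_n.+1, sigma i = 1 \/ sigma i = -1).
Implicit Types (i j : 'I_n.+1) (a : 'I_n.+1 -> R) (s : seq R) (t : R).

Let B := block sigma.
Let k := sign_variations sigma.

Lemma alpha_inj_of_incr : injective alpha.
Proof.
move=> i j eq_ij; apply: val_inj; case: (ltngtP i j) => // /alpha_incr;
  by rewrite eq_ij ltxx.
Qed.

Lemma block_lt i j : (B i < B j)%N -> alpha i < alpha j.
Proof.
move=> lt_B; apply: alpha_incr; rewrite ltnNge.
by apply: contraL lt_B => /(leq_block sigma); rewrite -leqNgt.
Qed.

Lemma sigma_neq0 i : sigma i != 0.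
Proof. by case: (sigma_sign i) => ->; rewrite ?oppr_eq0 oner_eq0. Qed.

(** The numbers b of [descartes_bound] are chosen between the two exponents of each
    sign variation, so that the product of the [alpha i - b] has the sign of
    [sigma i] up to a constant. *)
Lemma descartes_variations a s : (forall i, 0 < a i * sigma i) ->
  vanishes alpha a s -> (size s <= k)%N.
Proof.
move=> a_sign van.
pose w v := widen_ord (leqnSn n) v.
pose mid v := (alpha (w v) + alpha (lift ord0 v)) / 2.
have mid_lt (v : 'I_n) i : if (v < i)%N then mid v < alpha i else alpha i < mid v.
  have lt_v : alpha (w v) < alpha (lift ord0 v) by apply: alpha_incr; rewrite lift0.
  have le_alpha i' j' : (i' <= j')%N -> alpha i' <= alpha j'.
    by rewrite leq_eqVlt => /predU1P[/val_inj ->|/alpha_incr/ltW].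
  rewrite /mid; case: ltnP => [lt_vi|le_iv].
    have : alpha (lift ord0 v) <= alpha i by apply: le_alpha; rewrite lift0.
    lra.
  have : alpha i <= alpha (w v) by exact: le_alpha.
  lra.
pose bs := [seq mid v | v <- enum [set v | variation_at sigma v]].
have size_bs : size bs = k by rewrite size_map -cardE.
have VE i : \prod_(b <- bs) (alpha i - b) =
    \prod_(v | variation_at sigma v) (alpha i - mid v).
  by rewrite big_map big_enum; apply: eq_bigl => v; rewrite inE.
(* The factor of v has the sign (-1)^([v < i] + 1). *)
have V_sign i : 0 < ((-1) ^+ (B i + k) * \prod_(b <- bs) (alpha i - b)).
  rewrite VE; have -> : (B i + k = \sum_(v | variation_at sigma v) (v < i).+1)%N.
    rewrite /k -block_max /B /block -big_split; apply: eq_bigr => v _ /=.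
    by rewrite ltn_ord addn1.
  apply: signed_prod_gt0 => v _; have := mid_lt v i; rewrite exprS.
  by case: (v < i)%N; rewrite ?expr1 ?expr0; lra.
have aV_sign i : 0 < (a i * \prod_(b <- bs) (alpha i - b)) * ((-1) ^+ k * sigma ord0).
  have := mulr_gt0 (a_sign i) (V_sign i); rewrite (sigma_block sigma_sign i) -/B exprD.
  have := sqrr_sign R (B i); move: ((-1) ^+ B i) => e e2.
  congr (_ < _); rewrite -[RHS]mul1r -e2; move: (_ ^+ k) => u; ring.
rewrite -size_bs; apply: (descartes_bound van) => [i j|].
  exact/ltW/(same_sign_trans (aV_sign i) (aV_sign j)).
by exists ord0; apply: contraTneq (aV_sign ord0) => ->; rewrite mul0r ltxx.
Qed.

(** One index in each of the blocks numbered d, ..., d + q.  On them sigma alternates,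
    as do the coefficients of the interpolant, which can thus be scaled to agree with
    sigma.  By [support_bound] there is no root beyond s; this leaves a quotient
    of constant sign, that of the leading coefficient, whose block is the last. *)
Lemma signed_interpolant q d (g : 'I_q.+1 -> 'I_n.+1) s : size s = q ->
  (forall c, B (g c) = (c + d)%N) -> (q + d)%N = k ->
  exists a, [/\ forall i, i \notin codom g -> a i = 0,
    forall c, 0 < a (g c) * sigma (g c), vanishes alpha a s &
    forall t, 0 < sigma ord_max * quotient alpha a s t].
Proof.
move=> size_s Bg qd; pose S := [set g c | c : 'I_q.+1].
have g_inj : injective g.
  by move=> c c' /(congr1 B); rewrite !Bg => /addIn/val_inj.
have in_S i : (i \in S) = (i \in codom g).
  by apply/imsetP/codomP => [[c _ ->]|[c ->]]; exists c.
have gS c : g c \in S by rewrite in_S codom_f.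
have cardS : #|S| = q.+1 by rewrite card_imset // card_ord.
have [|a [supp_a nz van]] := @exists_vanishing R _ alpha S s.
  by rewrite cardS size_s.
have cardS' : #|S| = (size s).+1 by rewrite cardS size_s.
have signs := interpolant_signs alpha_inj_of_incr cardS' supp_a nz van.
have W_sign (c : 'I_q.+1) : 0 < (-1) ^+ (c + q) * nodal alpha (S :\ g c) (g c).
  by apply: nodal_sign => c1 c2 lt_c; apply: block_lt; rewrite !Bg ltn_add2r.
have sigW c : 0 < (sigma ord_max) * (sigma (g c) * nodal alpha (S :\ g c) (g c)).
  rewrite (sigma_block sigma_sign ord_max) (sigma_block sigma_sign (g c)).
  rewrite block_max -/k -qd -/(B (g c)) Bg.
  have := mulr_gt0 (W_sign c) (_ : 0 < sigma ord0 ^+ 2).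
  rewrite exprn_even_gt0 //= sigma_neq0 => /(_ isT).
  rewrite !exprD; have := sqrr_sign R d.
  move: ((-1) ^+ d) ((-1) ^+ c) ((-1) ^+ q) => e u w e2.
  congr (_ < _); rewrite -[LHS]mul1r -e2; ring.
(* Any number of the common sign of all the [a (g c) * sigma (g c)] would do. *)
pose e := sigma ord_max * a (g ord0) * nodal alpha (S :\ g ord0) (g ord0).
have aS c : 0 < e * a (g c) * sigma (g c).
  have pos := mulr_gt0 (sigW c) (signs _ _ (gS ord0) (gS c)).
  have W_neq0 : nodal alpha (S :\ g c) (g c) != 0.
    by apply: contraTneq (sigW c) => ->; rewrite !mulr0 ltxx.
  rewrite -(pmulr_lgt0 (x := nodal alpha (S :\ g c) (g c) ^+ 2)) ?exprn_even_gt0 //.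
  by move: pos; congr (_ < _); rewrite /e; ring.
have vane : vanishes alpha (fun i => e * a i) s.
  by move=> z p le_p; rewrite expsumZl van ?mulr0.
have aSn c : e * a (g c) != 0.
  by apply: contraTneq (aS c) => ->; rewrite mul0r ltxx.
exists (fun i => e * a i); split=> //.
  by move=> i ig; rewrite supp_a ?mulr0 // in_S.
have supp_e i : i \notin S -> e * a i = 0 by move=> /supp_a ->; rewrite mulr0.
have nz_e : exists i, e * a i != 0 by exists (g ord0).
have quo_neq0 t : quotient alpha (fun i => e * a i) s t != 0.
  rewrite quotient_eq0; apply/eqP => /(vanishes_cons vane) van_t.
  have := support_bound alpha_inj_of_incr supp_e nz_e van_t.
  by rewrite cardS /= size_s ltnn.
have max_g i : i != g ord_max -> e * a i != 0 -> alpha i < alpha (g ord_max).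
  move=> neq nzi; have : i \in S by apply: contraNT nzi => /supp_e ->.
  rewrite in_S => /codomP[c ic]; rewrite ic; apply: block_lt; rewrite !Bg ltn_add2r.
  rewrite ltn_neqAle -ltnS ltn_ord andbT; apply: contraNneq neq => eq_c.
  by rewrite ic (_ : c = ord_max) //; exact: val_inj.
have sig_max : sigma ord_max = sigma (g ord_max).
  rewrite (sigma_block sigma_sign (g ord_max)) (sigma_block sigma_sign ord_max).
  by rewrite block_max -/(B _) Bg qd.
move=> t; have := quotient_sign_max vane quo_neq0 max_g (aSn ord_max) t.
rewrite mulrC => h; rewrite sig_max mulrC.
by apply: same_sign_trans h _; rewrite mulrC aS.
Qed.

(** The piece [Some j] makes the coefficient of j nonzero and may have the extra root
    r; the piece [None] has no other root than s, and keeps the sum of all quotients,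
    which have the sign of [sigma ord_max], away from 0. *)
Lemma exists_exact s : (size s <= k)%N -> ~~ odd (k - size s) ->
  exists a, [/\ forall i, 0 < a i * sigma i, vanishes alpha a s &
    forall t, quotient alpha a s t != 0].
Proof.
move=> le_sk even_d; set d := (k - size s)%N in even_d.
have [r rs] : exists r : R, r \notin s.
  exists (\sum_(y <- s) `|y| + 1); apply/negP => ys.
  have := ler_norm (\sum_(y <- s) `|y| + 1).
  set r := _ + 1 in ys *; have : \sum_(y <- s) `|y| = `|r| + \sum_(y <- rem r s) `|y|.
    by rewrite (big_rem r ys).
  have : 0 <= \sum_(y <- rem r s) `|y| by apply: sumr_ge0.
  by rewrite /r; lra.
pose s' := nseq d r ++ s.
have size_s' : size s' = k by rewrite size_cat size_nseq subnK.
have rep c : {i | (c <= k)%N -> B i = c}.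
  apply: cid; have [le_c|_] := leqP c k; last by exists ord0.
  by have [i Bi] := block_onto le_c; exists i.
have leB i : (B i <= k)%N by rewrite /k -block_max; apply: leq_block; rewrite -ltnS.
have piece (o : option 'I_n.+1) : exists a, [/\ forall i, 0 <= a i * sigma i,
    forall i, o = Some i -> 0 < a i * sigma i, vanishes alpha a s &
    forall t, if o is Some _ then 0 <= sigma ord_max * quotient alpha a s t
              else 0 < sigma ord_max * quotient alpha a s t].
  case: o => [j|].
    pose g (c : 'I_k.+1) := if c == B j :> nat then j else sval (rep c).
    have Bg c : B (g c) = (c + 0)%N.
      rewrite addn0 /g; case: eqP => [-> //|_].
      by case: (rep c) => i /= ->; rewrite // -ltnS.
    have [a [supp_a sign_a van pos]] := signed_interpolant size_s' Bg (addn0 k).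
    exists a; split.
    - move=> i; have [/codomP[c ->]|/supp_a ->] := boolP (i \in codom g).
        exact/ltW.
      by rewrite mul0r.
    - move=> _ [<-]; have lt_j : (B j < k.+1)%N by rewrite ltnS.
      by have := sign_a (Ordinal lt_j); rewrite /g /= eqxx.
    - by apply: vanishes_sub van => z; rewrite count_cat leq_addl.
    - move=> t; rewrite (quotient_cat_nseq _ rs van) mulrA.
      by apply: mulr_ge0; [exact/ltW | exact: exprn_even_ge0].
  pose g (c : 'I_(size s).+1) := sval (rep (c + d)%N).
  have Bg c : B (g c) = (c + d)%N.
    rewrite /g; case: (rep _) => i /= -> //.
    by rewrite -[X in (_ <= X)%N](subnKC le_sk) leq_add2r -ltnS.
  have [a [supp_a sign_a van pos]] := signed_interpolant erefl Bg (subnKC le_sk).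
  exists a; split=> // i.
  have [/codomP[c ->]|/supp_a ->] := boolP (i \in codom g); first exact/ltW.
  by rewrite mul0r.
have [b bP] := choice piece.
exists (fun i => \sum_o b o i); split.
- move=> i; rewrite mulr_suml (bigD1 (Some i)) //= ltr_wpDr //.
    by apply: sumr_ge0 => o _; case: (bP o).
  by case: (bP (Some i)) => _ ->.
- move=> z q le_q; rewrite expsum_suml big1 // => o _.
  by case: (bP o) => _ _ ->.
- move=> t; rewrite quotient_suml.
  suff : 0 < sigma ord_max * \sum_o quotient alpha (b o) s t.
    by apply: contraTneq => ->; rewrite mulr0 ltxx.
  rewrite mulr_sumr (bigD1 None) //= ltr_wpDr //.
    apply: sumr_ge0 => o _; case: (bP o) => _ _ _ /(_ t).
    by case: o => // /ltW.
  by case: (bP None).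
Qed.

(** Compare the sign of the quotient near +oo and near -oo. *)
Lemma parity_variations a s : (forall i, 0 < a i * sigma i) ->
  vanishes alpha a s -> (forall t, quotient alpha a s t != 0) ->
  ~~ odd (k + size s).
Proof.
move=> a_sign van quo_neq0.
have a_neq0 i : a i != 0 by apply: contraTneq (a_sign i) => ->; rewrite mul0r ltxx.
have max_n i : i != ord_max -> a i != 0 -> alpha i < alpha ord_max.
  move=> neq _; apply: alpha_incr; rewrite ltn_neqAle -ltnS ltn_ord andbT.
  by apply: contraNneq neq => eq_i; apply/eqP/val_inj.
have min_0 i : i != ord0 -> a i != 0 -> alpha ord0 < alpha i.
  by move=> neq _; apply: alpha_incr; rewrite lt0n; apply: contraNneq neq => eq_i;
     apply/eqP/val_inj.
have hmax := quotient_sign_max van quo_neq0 max_n (a_neq0 _) 0.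
have hmin := quotient_sign_min van quo_neq0 min_0 (a_neq0 _) 0.
have pos := mulr_gt0 (same_sign_trans hmax hmin)
                     (mulr_gt0 (a_sign ord_max) (a_sign ord0)).
have sq_gt0 : 0 < (a ord_max * a ord0 * sigma ord0) ^+ 2.
  by rewrite exprn_even_gt0 //= !mulf_neq0 ?a_neq0 ?sigma_neq0.
rewrite -(signr_gt0 R) signr_odd exprD -(pmulr_lgt0 _ sq_gt0).
move: pos; rewrite (sigma_block sigma_sign ord_max) block_max -/k.
by congr (_ < _); ring.
Qed.

Theorem exact_iff s :
  (exists a, [/\ forall i, 0 < a i * sigma i, vanishes alpha a s &
     forall t, expsum alpha a 'X^(count_mem t s) t != 0]) <->
  (size s <= k)%N /\ ~~ odd (k - size s).
Proof.
split=> [[a [a_sign van exact_a]]|[le_sk even_d]].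
  have le_sk := descartes_variations a_sign van; split=> //.
  rewrite oddB // -oddD; apply: parity_variations a_sign van _ => t.
  by rewrite quotient_eq0.
have [a [a_sign van exact_a]] := exists_exact le_sk even_d.
by exists a; split=> // t; rewrite -quotient_eq0.
Qed.

End Existence.

(** * Back to generalized polynomials *)

Section GeneralizedPolynomials.
Context {R : realType} {n : nat} (alpha : 'I_n.+1 -> R).
Implicit Types (a : 'I_n.+1 -> R) (q : {poly R}) (x : R).

(** The falling factorial X (X - 1) ... (X - j + 1): up to the factor x^(-j), the j-th
    derivative in x is the operator falling_j(d/dt) in t = ln x. *)
Fixpoint falling (j : nat) : {poly R} :=
  if j is j'.+1 then falling j' * ('X - j'%:R%:P) else 1.

Lemma falling_monic j : falling j \is monic.
Proof. by elim: j => [|j IHj]; rewrite /= ?monic1 // monicMl ?monicXsubC. Qed.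

Lemma size_falling j : size (falling j) = j.+1.
Proof.
elim: j => [|j IHj] /=; first by rewrite size_poly1.
by rewrite size_Mmonic ?monicXsubC ?monic_neq0 ?falling_monic // size_XsubC IHj addn2.
Qed.

Lemma derive1n_gen_poly a j x : 0 < x ->
  derive1n j (gen_poly alpha a) x =
  expR (- (j%:R * ln x)) * expsum alpha a (falling j) (ln x).
Proof.
have powE (b y : R) : 0 < y -> y `^ b = expR (b * ln y).
  by move=> y_gt0; rewrite /powR gt_eqF.
suff derE (y : R) : 0 < y -> derive1n j (gen_poly alpha a) y =
    \sum_(i < n.+1) a i * (falling j).[alpha i] * y `^ (alpha i - j%:R).
  move=> x_gt0; rewrite derE // /expsum mulr_sumr; apply: eq_bigr => i _.
  by rewrite powE // mulrBl addrC expRD; ring.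
elim: j y => [|j IHj] y y_gt0.
  by apply: eq_bigr => i _; rewrite hornerC mulr1 subr0.
rewrite derive1nS derive1E.
pose h i z := a i * (falling j).[alpha i] * z `^ (alpha i - j%:R) : R.
have near_eq : \forall z \near nbhs y,
    derive1n j (gen_poly alpha a) z = (\sum_(i < n.+1) h i) z.
  near=> z; rewrite IHj ?fct_sumE //; near: z.
  exact: lt_nbhsr.
rewrite (@near_eq_derive R R^o R^o _ _ y 1 near_eq).
have dh i : is_derive y 1 (h i)
    (a i * (falling j).[alpha i] * ((alpha i - j%:R) * y `^ (alpha i - j%:R - 1))).
  exact: (@is_deriveZ R R^o R^o _ _ y 1 _ (is_derive1_powR _ y_gt0)).
have [_ ->] := is_derive_sum dh.
apply: eq_bigr => i _ /=.
rewrite hornerM hornerXsubC -!mulrA; congr (_ * (_ * (_ * _ `^ _))).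
rewrite -natr1; ring.
Unshelve. all: by end_near. Qed.

(** [falling m] and 'X^m differ by lower-degree terms, which do not count at a root
    of order m. *)
Lemma vanishing_orderE a x m : 0 < x ->
  vanishing_order (gen_poly alpha a) x m <->
  (forall q, (size q <= m)%N -> expsum alpha a q (ln x) = 0) /\
  expsum alpha a 'X^m (ln x) != 0.
Proof.
move=> x_gt0.
have der0 j : (derive1n j (gen_poly alpha a) x == 0) =
    (expsum alpha a (falling j) (ln x) == 0).
  by rewrite derive1n_gen_poly // mulf_eq0 gt_eqF ?expR_gt0.
have lead : (forall q, (size q <= m)%N -> expsum alpha a q (ln x) = 0) ->
    expsum alpha a 'X^m (ln x) = expsum alpha a (falling m) (ln x).
  move=> van; rewrite -[X in expsum _ _ X](subrK (falling m)) expsumDr van ?add0r //.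
  apply/leq_sizeP => j; rewrite leq_eqVlt => /predU1P[<-|lt_mj].
    rewrite coefB coefXn eqxx.
    have := monicP (falling_monic m).
    by rewrite lead_coefE size_falling /= => ->; rewrite subrr.
  by rewrite coefB !nth_default ?subr0 // ?size_polyXn ?size_falling.
split=> [[van0 nz]|[van nz]].
  have van : forall q, (size q <= m)%N -> expsum alpha a q (ln x) = 0.
    apply: (expsum_basis size_falling) => j lt_jm.
    by apply/eqP; rewrite -der0; apply/eqP/van0.
  by split=> //; rewrite lead // -der0; exact/eqP.
split=> [j lt_jm|]; last by apply/eqP; rewrite der0 -lead.
by apply/eqP; rewrite der0 van // size_falling.
Qed.

Lemma positive_root_msetE a (M : {mset R}%mset) : (forall x, x \in M -> 0 < x) ->
  let s := [seq ln x | x <- M] in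
  positive_root_mset (gen_poly alpha a) M <->
  vanishes alpha a s /\ forall t, expsum alpha a 'X^(count_mem t s) t != 0.
Proof.
move=> M_pos s.
have count_ln x : 0 < x -> count_mem (ln x) s = M x.
  move=> x_gt0; rewrite count_map -count_mem_mset.
  apply: eq_in_count => y /M_pos y_gt0 /=.
  by rewrite (inj_in_eq (@ln_inj R)).
have notin_count x : x \notin M -> M x = 0%N by move/mset_eq0P.
split=> [[rootM orderM]|[van exact_a]].
  have key t : (forall q, (size q <= count_mem t s)%N -> expsum alpha a q t = 0) /\
      expsum alpha a 'X^(count_mem t s) t != 0.
    have x_gt0 := expR_gt0 t; rewrite -[t]expRK; set x := expR t in x_gt0 *.
    rewrite count_ln //; apply/vanishing_orderE => //.
    have [xM|xM] := boolP (x \in M); first exact: orderM.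
    rewrite notin_count //; split=> // Fx0.
    by move/negP: xM; apply; apply/rootM.
  split=> [t q|t]; first by have [+ _] := key t; apply.
  by case: (key t).
have order x : 0 < x -> vanishing_order (gen_poly alpha a) x (M x).
  move=> x_gt0; apply/vanishing_orderE => //; rewrite -count_ln //.
  by split=> // q; exact: van.
split=> x; last by move=> /M_pos; exact: order.
split=> [xM|[x_gt0 Fx0]].
  have x_gt0 := M_pos _ xM; split=> //.
  by have [+ _] := order _ x_gt0; move=> /(_ 0%N); apply; rewrite mset_gt0.
apply/negPn/negP => /notin_count Mx0; have [_] := order _ x_gt0.
by rewrite Mx0; apply.
Qed.

End GeneralizedPolynomials.

Lemma signP (R : realFieldType) (x e : R) : e = 1 \/ e = -1 ->
  (x <> 0 /\ x / `|x| = e) <-> 0 < x * e.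
Proof.
move=> e_sign; split=> [[/eqP x_neq0 <-]|].
  by rewrite mulrA -expr2 divr_gt0 ?normr_gt0 // exprn_even_gt0.
have [x_gt0|x_lt0|->] := ltrgt0P x; last by rewrite mul0r ltxx.
  case: e_sign => ->; rewrite ?mulr1 ?mulrN1 => h.
    by split; [move=> x0; rewrite x0 ltxx in x_gt0 | rewrite divff // gt_eqF].
  by rewrite oppr_gt0 in h; have := lt_trans h x_gt0; rewrite ltxx.
case: e_sign => ->; rewrite ?mulr1 ?mulrN1 => h.
  by have := lt_trans h x_lt0; rewrite ltxx.
split; first by move=> x0; rewrite x0 ltxx in x_lt0.
by rewrite invrN mulrN divff // lt_eqF.
Qed.

Theorem proposition1 (R : realType) (n : nat) (alpha : 'I_n.+1 -> R)
    (alpha_incr : forall i j : 'I_n.+1, (i < j)%N -> alpha i < alpha j)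
    (sigma : 'I_n.+1 -> R)
    (sigma_sign : forall i : 'I_n.+1, sigma i = 1 \/ sigma i = -1)
    (M : {mset R}%mset)
    (M_pos : forall x : R, x \in M -> 0 < x) :
  let k := sign_variations sigma in
  let p := size M in
  (exists a : 'I_n.+1 -> R,
     (forall i : 'I_n.+1, a i <> 0 /\ a i / `|a i| = sigma i) /\
     positive_root_mset (gen_poly alpha a) M)
  <-> (p <= k)%N /\ ~~ odd (k - p)%N.
Proof.
move=> k p; have := exact_iff alpha_incr sigma_sign [seq ln x | x <- M].
rewrite size_map -/k -/p => <-; split=> [[a [a_sign rootsM]]|[a [a_sign van exact_a]]].
  exists a; have [van exact_a] := (positive_root_msetE alpha a M_pos).1 rootsM.
  by split=> // i; apply/(signP _ (sigma_sign i)).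
exists a; split; first by move=> i; apply/(signP _ (sigma_sign i)).
exact/(positive_root_msetE alpha a M_pos).
Qed.
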